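(* Let $(X,m_s)$ be a complete $M_s$-metric space and let $T:X\to X$ be a self mapping for which there is a constant $\lambda\in[0,\tfrac12)$ such that $$m_s(Tx,Tx,Ty)\le \lambda\,[\,m_s(x,x,Tx)+m_s(y,y,Ty)\,]\qquad\text{for all } x,y\in X.$$ Then $T$ has a unique fixed point $u\in X$, and $m_s(u,u,u)=0$.
   Context: For a nonempty set $X$ and a function $m_s:X^3\to[0,\infty)$ write $$m_{s_{x,y,z}}:=\min\{m_s(x,x,x),m_s(y,y,y),m_s(z,z,z)\},\qquad M_{s_{x,y,z}}:=\max\{m_s(x,x,x),m_s(y,y,y),m_s(z,z,z)\}.$$ The function $m_s$ is an $M_s$-metric on $X$, and $(X,m_s)$ is an $M_s$-metric space, if for all $x,y,z,t\in X$: (1) $m_s(x,x,x)=m_s(y,y,y)=m_s(x,x,y)$ if and only if $x=y$; (2) $m_{s_{x,y,z}}\le m_s(x,y,z)$; (3) $m_s(x,x,y)=m_s(y,y,x)$; (4) $m_s(x,y,z)-m_{s_{x,y,z}}\le (m_s(x,x,t)-m_{s_{x,x,t}})+(m_s(y,y,t)-m_{s_{y,y,t}})+(m_s(z,z,t)-m_{s_{z,z,t}})$. A sequence $\{x_n\}$ in $X$ converges to $x\in X$ if $\lim_{n\to\infty}(m_s(x_n,x_n,x)-m_{s_{x_n,x_n,x}})=0$. A sequence $\{x_n\}$ is $M_s$-Cauchy if the limits $\lim_{n,m\to\infty}(m_s(x_n,x_n,x_m)-m_{s_{x_n,x_n,x_m}})$ and $\lim_{n,m\to\infty}(M_{s_{x_n,x_n,x_m}}-m_{s_{x_n,x_n,x_m}})$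 exist and are finite. The space $(X,m_s)$ is complete if every $M_s$-Cauchy sequence $\{x_n\}$ converges to a point $x\in X$ such that $\lim_{n\to\infty}(m_s(x_n,x_n,x)-m_{s_{x_n,x_n,x}})=0$ and $\lim_{n\to\infty}(M_{s_{x_n,x_n,x}}-m_{s_{x_n,x_n,x}})=0$. *)

(* Defs.v *)
From HB Require Import structures.
From mathcomp Require Import all_boot all_order all_algebra.
From mathcomp Require Import all_classical all_reals all_analysis.

Set Implicit Arguments.
Unset Strict Implicit.
Unset Printing Implicit Defensive.

Import Order.TTheory GRing.Theory Num.Theory.
Import numFieldNormedType.Exports.

Local Open Scope classical_set_scope.
Local Open Scope ring_scope.

Definition ms_min (R : realType) (X : Type) (ms : X -> X -> X -> R)
    (x y z : X) : R :=
  Num.min (Num.min (ms x x x) (ms y y y)) (ms z z z).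

Definition ms_max (R : realType) (X : Type) (ms : X -> X -> X -> R)
    (x y z : X) : R :=
  Num.max (Num.max (ms x x x) (ms y y y)) (ms z z z).

Record Ms_metric (R : realType) (X : Type) (ms : X -> X -> X -> R) : Prop := {
  Ms_ge0 : forall x y z, 0 <= ms x y z;
  Ms_eq : forall x y,
    (ms x x x = ms y y y /\ ms y y y = ms x x y) <-> x = y;
  Ms_min_le : forall x y z, ms_min ms x y z <= ms x y z;
  Ms_sym : forall x y, ms x x y = ms y y x;
  Ms_triangle : forall x y z t,
    ms x y z - ms_min ms x y z <=
      (ms x x t - ms_min ms x x t) +
      (ms y y t - ms_min ms y y t) +
      (ms z z t - ms_min ms z z t)
}.

Definition Ms_converges (R : realType) (X : Type) (ms : X -> X -> X -> R)
    (u : nat -> X) (x : X) : Prop :=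
  ms (u n) (u n) x - ms_min ms (u n) (u n) x @[n --> \oo] --> (0 : R).

(* Double limits are joint limits, along the product filter on nat * nat;
   finiteness is automatic because the limits lie in R. *)
Definition Ms_cauchy (R : realType) (X : Type) (ms : X -> X -> X -> R)
    (u : nat -> X) : Prop :=
  (exists l : R,
     ms (u p.1) (u p.1) (u p.2) - ms_min ms (u p.1) (u p.1) (u p.2)
       @[p --> filter_prod \oo \oo] --> l) /\
  (exists l : R,
     ms_max ms (u p.1) (u p.1) (u p.2) - ms_min ms (u p.1) (u p.1) (u p.2)
       @[p --> filter_prod \oo \oo] --> l).

Definition Ms_complete (R : realType) (X : Type) (ms : X -> X -> X -> R) :
    Prop :=
  forall u : nat -> X, Ms_cauchy ms u ->
  exists x : X, Ms_converges ms u x /\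
    ms_max ms (u n) (u n) x - ms_min ms (u n) (u n) x @[n --> \oo] --> (0 : R).

(* Main.v *)
Require Import Defs.
From HB Require Import structures.
From mathcomp Require Import all_boot all_order all_algebra.
From mathcomp Require Import all_classical all_reals all_analysis.
From mathcomp Require Import lra.

(** A map satisfying the inequality of the theorem (a Kannan contraction)
    shrinks the steps of its orbits: applied to the points [x] and [T x], the
    inequality has the step of [T x] on both sides, and solving for it gives
    the ratio [k = lambda / (1 - lambda)], which is [< 1] exactly because
    [lambda < 1/2].  So the steps [ms x_n x_n x_(n+1)] of any orbit
    [x_n = T^n x_0] tend to 0 ([kannan_steps_cvg0]).

    The inequality also bounds [ms x_n x_n x_m] by the two preceding steps;
    hence this double sequence, and with [m = n] the self-distances
    [ms x_n x_n x_n], tend to 0 ([kannan_orbit_vanishing]).  Since the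
    subtracted minima are nonnegative, the orbit is Cauchy
    ([Ms_cauchy_vanishing]), and its limit [u] has self-distance 0 and
    satisfies [ms x_n x_n u -> 0] ([Ms_complete_vanishing]).

    As [ms u u u = 0], the minimum on the left of the triangle inequality
    disappears, and passing through [x_n] one gets
    [ms u u (T u) <= 2 ms u u x_n + ms (T u) (T u) x_n].  The last term is at
    most [lambda * (ms u u (T u) + (step before x_n))], so in the limit
    [ms u u (T u) <= lambda * ms u u (T u)], which forces [ms u u (T u) = 0]
    and then [T u = u] ([kannan_limit_fixed]).

    Every fixed point has self-distance 0 by the inequality applied with
    [x = y], since [2 lambda < 1]; the inequality then puts two fixed points at
    distance 0, so they are equal. *)

Set Implicit Arguments.
Unset Strict Implicit.
Unset Printing Implicit Defensive.

Import Order.TTheory GRing.Theory Num.Theory.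
Import numFieldNormedType.Exports.

Local Open Scope classical_set_scope.
Local Open Scope ring_scope.

Definition kannan (R : realType) (X : Type) (ms : X -> X -> X -> R)
    (T : X -> X) (lambda : R) : Prop :=
  forall x y : X,
    ms (T x) (T x) (T y) <= lambda * (ms x x (T x) + ms y y (T y)).

Lemma ms_minxx (R : realType) (X : Type) (ms : X -> X -> X -> R) (x y : X) :
  ms_min ms x x y = Num.min (ms x x x) (ms y y y).
Proof. by rewrite /ms_min minxx. Qed.

(** This turns the second limit in the Cauchy and completeness conditions into
    a statement on self-distances alone. *)
Lemma ms_maxBmin (R : realType) (X : Type) (ms : X -> X -> X -> R) (x y : X) :
  ms_max ms x x y - ms_min ms x x y = `|ms x x x - ms y y y|.
Proof. rewrite ms_minxx /ms_max maxxx maxr_absE minr_absE; lra. Qed.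

Lemma ms_min_ge0 (R : realType) (X : Type) (ms : X -> X -> X -> R)
    (hms : Ms_metric ms) (x y : X) : 0 <= ms_min ms x x y.
Proof. by rewrite ms_minxx le_min !(Ms_ge0 hms). Qed.

Lemma Ms_metric_eq0 (R : realType) (X : Type) (ms : X -> X -> X -> R)
    (hms : Ms_metric ms) (x y : X) :
  ms x x x = 0 -> ms y y y = 0 -> ms x x y <= 0 -> x = y.
Proof.
move=> x0 y0 xy; apply/(Ms_eq hms); rewrite x0 y0; split=> //.
by apply/eqP; rewrite eq_le xy (Ms_ge0 hms).
Qed.

(** Both Cauchy limits are then 0: the corrected distance lies between 0 and
    the distance, and the spread of the self-distances is a difference of two
    null sequences. *)
Lemma Ms_cauchy_vanishing (R : realType) (X : Type) (ms : X -> X -> X -> R)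
    (hms : Ms_metric ms) (u : nat -> X) :
  ms (u n) (u n) (u n) @[n --> \oo] --> (0 : R) ->
  ms (u p.1) (u p.1) (u p.2) @[p --> filter_prod \oo \oo] --> (0 : R) ->
  Ms_cauchy ms u.
Proof.
move=> self0 pair0.
have self1 : ms (u p.1) (u p.1) (u p.1) @[p --> filter_prod \oo \oo] --> (0 : R).
  exact: cvg_comp cvg_fst self0.
have self2 : ms (u p.2) (u p.2) (u p.2) @[p --> filter_prod \oo \oo] --> (0 : R).
  exact: cvg_comp cvg_snd self0.
split; exists 0.
  apply: (squeeze_cvgr _ (cvg_cst 0) pair0); apply: nearW => p.
  by rewrite subr_ge0 (Ms_min_le hms) gerBl ms_min_ge0.
have diff0 : ms (u p.1) (u p.1) (u p.1) - ms (u p.2) (u p.2) (u p.2)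
    @[p --> filter_prod \oo \oo] --> (0 : R).
  by rewrite -[X in _ --> X](subr0 0); exact: cvgB self1 self2.
under eq_fun do rewrite ms_maxBmin.
by apply/norm_cvg0P.
Qed.

(** The limit inherits self-distance 0 because differences of self-distances
    tend to 0 along the sequence; only then does the convergence of the
    corrected quantity give that of [ms u_n u_n x] itself. *)
Lemma Ms_complete_vanishing (R : realType) (X : Type) (ms : X -> X -> X -> R)
    (hms : Ms_metric ms) (hcomplete : Ms_complete ms) (u : nat -> X) :
  Ms_cauchy ms u ->
  ms (u n) (u n) (u n) @[n --> \oo] --> (0 : R) ->
  exists x : X, ms x x x = 0 /\ ms (u n) (u n) x @[n --> \oo] --> (0 : R).
Proof.
move=> /hcomplete[x [cvgux selfux]] self0; exists x.
have diff0 : ms (u n) (u n) (u n) - ms x x x @[n --> \oo] --> (0 : R).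
  by apply/norm_cvg0P; under eq_fun do rewrite -ms_maxBmin.
have xx0 : ms x x x = 0.
  apply/eqP; rewrite eq_le (Ms_ge0 hms) andbT -[X in _ <= X](subr0 0).
  apply: (cvgr_to_ge (cvgB self0 diff0)); apply: nearW => n.
  by rewrite !fctE subKr.
split=> //; move: cvgux; rewrite /Ms_converges.
under eq_fun do rewrite ms_minxx xx0 min_r ?(Ms_ge0 hms)// subr0.
by [].
Qed.

Lemma kannan_step (R : realType) (X : Type) (ms : X -> X -> X -> R)
    (T : X -> X) (lambda : R) (hlambda : 0 <= lambda < 2^-1)
    (hT : kannan ms T lambda) (x : X) :
  ms (T x) (T x) (T (T x)) <= lambda / (1 - lambda) * ms x x (T x).
Proof.
have := hT x (T x) => step.
have l1 : 0 < 1 - lambda by lra.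
rewrite mulrAC ler_pdivlMr//; lra.
Qed.

Lemma kannan_steps_cvg0 (R : realType) (X : Type) (ms : X -> X -> X -> R)
    (hms : Ms_metric ms) (T : X -> X) (lambda : R)
    (hlambda : 0 <= lambda < 2^-1) (hT : kannan ms T lambda) (x : X) :
  ms (iter n T x) (iter n T x) (iter n.+1 T x) @[n --> \oo] --> (0 : R).
Proof.
set k := lambda / (1 - lambda).
have l1 : 0 < 1 - lambda by lra.
have k0 : 0 <= k by rewrite divr_ge0//; lra.
have k1 : `|k| < 1 by rewrite ger0_norm// ltr_pdivrMr//; lra.
have bound n :
    ms (iter n T x) (iter n T x) (iter n.+1 T x) <= geometric (ms x x (T x)) k n.
  elim: n => [|n ih]; first by rewrite /= expr0 mulr1.
  apply: (le_trans (kannan_step hlambda hT _)).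
  by rewrite /= exprS mulrCA ler_wpM2l.
apply: (squeeze_cvgr _ (cvg_cst 0) (cvg_geometric (ms x x (T x)) k1)).
by apply: nearW => n; rewrite (Ms_ge0 hms) bound.
Qed.

(** The orbit starts at [T x], not [x], so that every point is an image under
    [T] and the contraction inequality applies to all pairs. *)
Lemma kannan_orbit_vanishing (R : realType) (X : Type) (ms : X -> X -> X -> R)
    (hms : Ms_metric ms) (T : X -> X) (lambda : R)
    (hlambda : 0 <= lambda < 2^-1) (hT : kannan ms T lambda) (x : X) :
  ms (iter p.1.+1 T x) (iter p.1.+1 T x) (iter p.2.+1 T x)
    @[p --> filter_prod \oo \oo] --> (0 : R) /\
  ms (iter n.+1 T x) (iter n.+1 T x) (iter n.+1 T x) @[n --> \oo] --> (0 : R).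
Proof.
pose d n := ms (iter n T x) (iter n T x) (iter n.+1 T x).
have d0 : d n @[n --> \oo] --> (0 : R) by exact: (kannan_steps_cvg0 hms hlambda hT).
have sum0 (I : Type) (F : set_system I) (FF : Filter F) (f g : I -> nat) :
    f i @[i --> F] --> \oo -> g i @[i --> F] --> \oo ->
    lambda * (d (f i) + d (g i)) @[i --> F] --> (0 : R).
  move=> f_oo g_oo; rewrite -[X in _ --> X](mulr0 lambda) -[in X in _ --> X](addr0 0).
  by apply: cvgMr; apply: cvgD; [exact: (cvg_comp _ _ f_oo d0)|exact: (cvg_comp _ _ g_oo d0)].
split.
  apply: (squeeze_cvgr _ (cvg_cst 0) (sum0 _ _ _ _ _ cvg_fst cvg_snd)).
  by apply: nearW => p; rewrite (Ms_ge0 hms) hT.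
apply: (squeeze_cvgr _ (cvg_cst 0) (sum0 _ _ _ _ _ cvg_id cvg_id)).
by apply: nearW => n; rewrite (Ms_ge0 hms) hT.
Qed.

Lemma kannan_fixed_self0 (R : realType) (X : Type) (ms : X -> X -> X -> R)
    (hms : Ms_metric ms) (T : X -> X) (lambda : R)
    (hlambda : 0 <= lambda < 2^-1) (hT : kannan ms T lambda) (v : X) :
  T v = v -> ms v v v = 0.
Proof.
move=> Tv; have := hT v v; have := Ms_ge0 hms v v v; rewrite !Tv => v0 vle.
nra.
Qed.

(** A limit of an orbit is fixed: the triangle inequality through [T x_n]
    bounds [ms u u (T u)] by [lambda * ms u u (T u)] plus a null sequence. *)
Lemma kannan_limit_fixed (R : realType) (X : Type) (ms : X -> X -> X -> R)
    (hms : Ms_metric ms) (T : X -> X) (lambda : R)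
    (hlambda : 0 <= lambda < 2^-1) (hT : kannan ms T lambda) (x u : X) :
  ms u u u = 0 ->
  ms (iter n.+1 T x) (iter n.+1 T x) u @[n --> \oo] --> (0 : R) ->
  T u = u.
Proof.
move=> u0 cvgu; set D := ms u u (T u).
have l1 : 0 < 1 - lambda by lra.
have D0 : 0 <= D by exact: Ms_ge0.
pose e n := ms (iter n.+1 T x) (iter n.+1 T x) u *+ 2 +
  lambda * ms (iter n T x) (iter n T x) (iter n.+1 T x).
have e0 : e n @[n --> \oo] --> (0 : R).
  rewrite -[X in _ --> X](addr0 0) -{1}(mul0rn _ 2) -[X in _ + X](mulr0 lambda).
  apply: cvgD; first exact: cvgMn.
  by apply: cvgMr; exact: (kannan_steps_cvg0 hms hlambda hT).
have Dle n : (1 - lambda) * D <= e n.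
  have := Ms_triangle hms u u (T u) (iter n.+1 T x).
  rewrite ms_minxx u0 min_l ?(Ms_ge0 hms)// (Ms_sym hms u (iter _ _ _)).
  have := hT u (iter n T x).
  have := ms_min_ge0 hms u (iter n.+1 T x).
  have := ms_min_ge0 hms (T u) (iter n.+1 T x).
  rewrite /e /D mulr2n /=; lra.
have De : (1 - lambda) * D <= 0 by apply: (cvgr_to_ge e0); exact: nearW.
have {De} DE : D = 0.
  by apply/eqP; rewrite eq_le D0 andbT -(pmulr_rle0 _ l1).
apply/esym/(Ms_metric_eq0 hms) => //; last by rewrite -/D DE.
by apply/eqP; rewrite eq_le (Ms_ge0 hms) andbT; have := hT u u; rewrite -/D DE; lra.
Qed.

Theorem theorem2 (R : realType) (X : Type) (hX : inhabited X)
    (ms : X -> X -> X -> R) (hms : Ms_metric ms) (hcomplete : Ms_complete ms)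
    (T : X -> X) (lambda : R) (hlambda : 0 <= lambda < 2^-1)
    (hT : forall x y : X,
       ms (T x) (T x) (T y) <= lambda * (ms x x (T x) + ms y y (T y))) :
  exists u : X,
    [/\ T u = u, forall v : X, T v = v -> v = u & ms u u u = 0].
Proof.
case: hX => x.
have [pair0 self0] := kannan_orbit_vanishing hms hlambda hT x.
have [u [u0 cvgu]] := Ms_complete_vanishing hms hcomplete
  (Ms_cauchy_vanishing hms (u := fun n => iter n.+1 T x) self0 pair0) self0.
have Tu : T u = u := kannan_limit_fixed hms hlambda hT u0 cvgu.
exists u; split=> // v Tv.
have v0 := kannan_fixed_self0 hms hlambda hT Tv.
apply: (Ms_metric_eq0 hms) => //.
by have := hT v u; rewrite !Tv !Tu u0 v0; lra.
Qed.
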